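(* Let $n\ge1$ be an integer and $f\in C(\overline\Omega_H)$. Define $$\mathcal I_n^*f(\mathbf t)=\sum_{\mathbf j\in\mathbb H_n^*}f(\tfrac{\mathbf j}{4n})\,\ell_{\mathbf j,n}(\mathbf t),\qquad \ell_{\mathbf j,n}(\mathbf t)=\Phi_n^*(\mathbf t-\tfrac{\mathbf j}{4n}),\qquad \Phi^*_n(\mathbf t)=\frac1{4n^3}\sum_{\mathbf k\in\mathbb H_n^*}c^{(n)}_{\mathbf k}\phi_{\mathbf k}(\mathbf t).$$ Then $\mathcal I_n^*f\in\mathcal T_n$ and $$\mathcal I_n^*f(\tfrac{\mathbf j}{4n})=\begin{cases} f(\tfrac{\mathbf j}{4n}), & \mathbf j\in\mathbb H_n^\circ,\\ \sum_{\mathbf k\in\mathcal S_{\mathbf j}}f(\tfrac{\mathbf k}{4n}), & \mathbf j\in\mathbb H_n^*\setminus\mathbb H_n^\circ.\end{cases}$$ Furthermore, $\Phi_n^*$ is a real function and $$\Phi_n^*(\mathbf t)=\frac1{4n^3}\Big[\tfrac12\big(D_n^H(\mathbf t)+D_{n-1}^H(\mathbf t)\big)-\tfrac13\sum_{\nu=1}^4\frac{\sin (n-1)\pi t_\nu}{\sin\pi t_\nu}\sum_{\substack{j=1\\ j\ne\nu}}^4\cos n\pi(2t_j+t_\nu)-\tfrac12\sum_{j=1}^4\cos 2\pi n t_j-\tfrac13\sum_{1\le\mu<\nu\le 4}\cos 2\pi n(t_\mu+t_\nu)\Big].$$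
   Context: Let $\mathbb R^4_H=\{\mathbf t\in\mathbb R^4: t_1+t_2+t_3+t_4=0\}$, $\mathbb Z^4_H=\mathbb Z^4\cap\mathbb R^4_H$, $\Omega_H=\{\mathbf t\in\mathbb R^4_H: -1<t_i-t_j\le1,\ 1\le i<j\le 4\}$ with closure $\overline\Omega_H$; functions on $\overline\Omega_H$ are evaluated via their restriction. Let $\mathbb H=\{\mathbf k\in\mathbb Z^4_H: k_1\equiv k_2\equiv k_3\equiv k_4\pmod4\}$, $\phi_{\mathbf k}(\mathbf t)=e^{\frac{\pi i}{2}\mathbf k\cdot\mathbf t}$, $\mathbb H_m^*=\{\mathbf k\in\mathbb H: -4m\le k_i-k_j\le 4m,\ 1\le i<j\le4\}$, $\mathbb H_n^\circ=\{\mathbf k\in\mathbb H: -4n<k_i-k_j<4n \text{ for all } i\neq j\}$, $\mathcal T_n=\operatorname{span}\{\phi_{\mathbf k}:\mathbf k\in\mathbb H_n^*\}$, and $D_m^H(\mathbf t)=\sum_{\mathbf k\in\mathbb H_m^*}\phi_{\mathbf k}(\mathbf t)$. For $\mathbf k\in\mathbb H_n^*$, $c^{(n)}_{\mathbf k}=1$ if $\max_ik_i-\min_ik_i<4n$, and otherwise $c^{(n)}_{\mathbf k}=1/\binom{p+q}{p}$ where $p$ (resp. $q$) is the number of coordinates equal to $\max_ik_i$ (resp. $\min_ik_i$). For $\mathbf j\in\mathbb H_n^*$, $\mathcal S_{\mathbf j}=\{\mathbf k\in\mathbb H_n^*: \mathbf k-\mathbf j\in 4n\,\mathbb Z^4_H\}$.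 Quotients of sines are understood by continuous extension. *)

(* Defs.v *)
From HB Require Import structures.
From mathcomp Require Import all_boot all_order all_algebra.
From mathcomp Require Import all_classical all_reals all_analysis.
From mathcomp Require Import complex.

Set Implicit Arguments.
Unset Strict Implicit.
Unset Printing Implicit Defensive.

Import numFieldNormedType.Exports.
Import Order.TTheory GRing.Theory Num.Theory.

Local Open Scope classical_set_scope.
Local Open Scope ring_scope.
Local Open Scope complex_scope.

Section Defs.
Variable R : realType.

Definition pt := 'I_4 -> R.
Definition lat := {ffun 'I_4 -> int}.

Definition inRH (t : pt) : Prop := \sum_(i < 4) t i = 0.

Definition inOmegaHbar (t : pt) : Prop :=
  inRH t /\ forall i j : 'I_4, (i < j)%N -> -1 <= t i - t j <= 1.

Definition continuous_on_set (A : pt -> Prop) (f : pt -> R[i]) : Prop :=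
  forall t, A t -> forall e : R, 0 < e ->
    exists2 d : R, 0 < d &
      forall s, A s -> (forall i, `|s i - t i| < d) -> `|f s - f t| < e%:C.

Definition inH (k : lat) : bool :=
  (\sum_(i < 4) k i == 0) && [forall i, forall j, (4 %| k i - k j)%Z].

Definition inHstar (m : nat) (k : lat) : bool :=
  inH k && [forall i : 'I_4, forall j : 'I_4,
    (i < j)%N ==> ((- (4 * m)%:Z <= k i - k j) && (k i - k j <= (4 * m)%:Z))].

Definition inHcirc (n : nat) (k : lat) : bool :=
  inH k && [forall i : 'I_4, forall j : 'I_4,
    (i != j) ==> ((- (4 * n)%:Z < k i - k j) && (k i - k j < (4 * n)%:Z))].

(* all integer vectors with entries in [-4m, 4m] (each element of H_m^star
   satisfies |k_i| <= 3m, so this box contains H_m^star) *)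
Definition box (m : nat) : seq lat :=
  map (fun a : {ffun 'I_4 -> 'I_(8 * m + 1)} =>
         [ffun i => (nat_of_ord (a i))%:Z - (4 * m)%:Z] : lat)
      (enum {: {ffun 'I_4 -> 'I_(8 * m + 1)}}).

(* the finite set H_m^star, as a duplicate-free list *)
Definition Hstar (m : nat) : seq lat := [seq k <- box m | inHstar m k].

Definition phi (k : lat) (t : pt) : R[i] :=
  let x := pi / 2 * \sum_(i < 4) (k i)%:~R * t i in cos x +i* sin x.

Definition pt_of (n : nat) (j : lat) : pt := fun i => (j i)%:~R / (4 * n)%:R.

Definition inTn (n : nat) (g : pt -> R[i]) : Prop :=
  exists a : lat -> R[i],
    forall t, inRH t -> g t = \sum_(k <- Hstar n) a k * phi k t.

Definition DH (m : nat) (t : pt) : R[i] := \sum_(k <- Hstar m) phi k t.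

Definition kmax (k : lat) : int := \big[Num.max/k ord0]_(i < 4) k i.
Definition kmin (k : lat) : int := \big[Num.min/k ord0]_(i < 4) k i.

Definition coef (n : nat) (k : lat) : R :=
  if kmax k - kmin k < (4 * n)%:Z then 1
  else
    let p := #|[pred i : 'I_4 | k i == kmax k]| in
    let q := #|[pred i : 'I_4 | k i == kmin k]| in
    1 / ('C(p + q, p))%:R.

Definition Phistar (n : nat) (t : pt) : R[i] :=
  (1 / (4 * n ^ 3)%:R)%:C * \sum_(k <- Hstar n) (coef n k)%:C * phi k t.

Definition ell (n : nat) (j : lat) (t : pt) : R[i] :=
  Phistar n (fun i => t i - pt_of n j i).

Definition Interp (n : nat) (f : pt -> R[i]) (t : pt) : R[i] :=
  \sum_(j <- Hstar n) f (pt_of n j) * ell n j t.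

Definition Sset (n : nat) (j : lat) : seq lat :=
  seq.filter (fun k : lat => [forall i, ((4 * n)%:Z %| k i - j i)%Z]
                         && (\sum_(i < 4) (k i - j i) == 0)) (Hstar n).

Definition sinq (m : nat) (x : R) : R :=
  if sin (pi * x) != 0 then sin (m%:R * pi * x) / sin (pi * x)
  else lim (sin (m%:R * pi * y) / sin (pi * y) @[y --> x^']).

Definition Phistar_formula (n : nat) (t : pt) : R[i] :=
  (1 / (4 * n ^ 3)%:R)%:C *
  ( (1 / 2)%:C * (DH n t + DH n.-1 t)
    - (1 / 3 * \sum_(nu < 4) (sinq n.-1 (t nu) *
          \sum_(j < 4 | j != nu) cos (n%:R * pi * (2 * t j + t nu))))%:C
    - (1 / 2 * \sum_(j < 4) cos (2 * pi * n%:R * t j))%:C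
    - (1 / 3 * \sum_(mu < 4) \sum_(nu < 4 | (mu < nu)%N)
          cos (2 * pi * n%:R * (t mu + t nu)))%:C ).

End Defs.

(* Main.v *)
Require Import Defs.
From HB Require Import structures.
From mathcomp Require Import all_boot all_order all_algebra.
From mathcomp Require Import all_classical all_reals all_analysis.
From mathcomp Require Import complex.
From mathcomp Require Import zify ring lra.
Import numFieldNormedType.Exports.
Import Order.TTheory GRing.Theory Num.Theory.
Local Open Scope ring_scope.
Local Open Scope complex_scope.

(* Interpolation: H / 4nZ^4_H has order 4n^3, and the coefficients c_k give total
   weight 1 to every class meeting H_n^*, because the members of H_n^* congruent
   to a boundary point k are exactly the C(p+q,p) points obtained by choosing
   which p of its p+q extremal coordinates are maximal.  Hence the weighted sum
   defining Phi_n^* at a node is a full character sum over the finite group, so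
   Phi_n^*((j-k)/4n) is 1 or 0 according as j and k are congruent or not.

   Closed formula: c_k is 1 inside, and 1/2, 1/3, 1/4 or 1/6 on the boundary
   according to {p,q}.  The half-sum of D_n and D_(n-1) accounts for 1 and 1/2;
   the points with p+q = 3 form arithmetic progressions, whose cosine sums give
   the sine quotients, and those with p+q = 4 give the last two sums. *)

(** * Four coordinates and the finite sets H_m^* *)

Local Notation i0 := (@Ordinal 4 0 isT).
Local Notation i1 := (@Ordinal 4 1 isT).
Local Notation i2 := (@Ordinal 4 2 isT).
Local Notation i3 := (@Ordinal 4 3 isT).

Lemma sum_ord4 (V : nmodType) (F : 'I_4 -> V) :
  \sum_(i < 4) F i = F i0 + F i1 + F i2 + F i3.
Proof.
rewrite !big_ord_recl big_ord0 addr0 !addrA.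
by congr (F _ + F _ + F _ + F _); apply: val_inj.
Qed.

Lemma ord4_ind (P : 'I_4 -> Prop) : P i0 -> P i1 -> P i2 -> P i3 -> forall i, P i.
Proof.
move=> p0 p1 p2 p3 -[[|[|[|[|//]]]] lti].
- by rewrite (_ : Ordinal lti = i0) //; apply: val_inj.
- by rewrite (_ : Ordinal lti = i1) //; apply: val_inj.
- by rewrite (_ : Ordinal lti = i2) //; apply: val_inj.
- by rewrite (_ : Ordinal lti = i3) //; apply: val_inj.
Qed.

Lemma inHP (k : lat) :
  reflect (k i0 + k i1 + k i2 + k i3 = 0 /\ forall i j, (4 %| k i - k j)%Z) (inH k).
Proof.
apply: (iffP andP) => [[/eqP + /forallP h]|[h1 h2]].
  by rewrite sum_ord4; split=> // i j; have /forallP := h i; apply.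
rewrite sum_ord4 h1; split=> //.
by apply/forallP => i; apply/forallP.
Qed.

Lemma inHstarP (m : nat) (k : lat) :
  reflect (inH k /\ forall i j, k i - k j <= (4 * m)%:Z) (inHstar m k).
Proof.
apply: (iffP andP) => [[-> /forallP h]|[-> h]]; split=> //.
  move=> i j; case: (ltngtP i j) => [lij|lji|/val_inj->]; last by lia.
    by have /forallP/(_ j)/implyP/(_ lij)/andP[] := h i.
  by have /forallP/(_ i)/implyP/(_ lji)/andP[] := h j; lia.
apply/forallP => i; apply/forallP => j; apply/implyP => _; rewrite h andbT.
by have := h j i; lia.
Qed.

(** Since 4 k_i is the sum over j of k_i - k_j, every element satisfies |k_i| <= 3m, so restricting
    to [box] loses nothing. *)
Lemma mem_Hstar (m : nat) (k : lat) : (k \in Hstar m) = inHstar m k.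
Proof.
rewrite mem_filter; case: inHstarP => //= -[/inHP[h0 _] h1].
have hb i : - (4 * m)%:Z <= k i <= (4 * m)%:Z.
  have {}h1 (j : 'I_4) := (h1 i j, h1 j i); move: (h1 i0) (h1 i1) (h1 i2) (h1 i3).
  by move=> [] ? ? [] ? ? [] ? ? [] ? ?; clear h1; lia.
have hlt i : (absz (k i + (4 * m)%:Z)%R < 8 * m + 1)%N by have := hb i; lia.
apply/mapP; exists [ffun i => Ordinal (hlt i)]; first by rewrite mem_enum.
by apply/ffunP => i; rewrite !ffunE /=; have := hb i; lia.
Qed.

Lemma uniq_Hstar (m : nat) : uniq (Hstar m).
Proof.
rewrite filter_uniq // map_inj_uniq ?enum_uniq // => a b /ffunP eab.
by apply/ffunP => i; apply: val_inj; have := eab i; rewrite !ffunE /=; lia.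
Qed.

Lemma latD (k l : lat) (i : 'I_4) : (k + l) i = k i + l i :> int.
Proof. exact: ffunE. Qed.

Lemma latN (k : lat) (i : 'I_4) : (- k) i = - k i :> int.
Proof. exact: ffunE. Qed.

Lemma latP (k l : lat) : (forall i : 'I_4, k i = l i) -> k = l.
Proof. by move=> h; apply/ffunP => i; apply: h. Qed.

Definition latE := (latD, latN).

Lemma inHD (k l : lat) : inH k -> inH l -> inH (k + l).
Proof.
move=> /inHP[k0 k4] /inHP[l0 l4]; apply/inHP; split=> [|i j]; rewrite ?latE.
  by lia.
by have := (k4 i j, l4 i j) => -[]; lia.
Qed.

Lemma inHN (k : lat) : inH k -> inH (- k).
Proof.
move=> /inHP[k0 k4]; apply/inHP; split=> [|i j]; rewrite ?latE.
  by lia.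
by have := k4 i j; lia.
Qed.

Lemma inHstarN (m : nat) (k : lat) : inHstar m (- k) = inHstar m k.
Proof.
have imp l : inHstar m l -> inHstar m (- l).
  move=> /inHstarP[/inHN ? h]; apply/inHstarP; split=> // i j.
  by rewrite !latE; have := h j i; lia.
by apply/idP/idP => /imp //; rewrite opprK.
Qed.

(** The symmetry behind every pairing of k with -k below, in particular behind the reality of the
    kernel. *)
Lemma perm_HstarN (m : nat) : perm_eq (map -%R (Hstar m)) (Hstar m).
Proof.
apply: uniq_perm; rewrite ?uniq_Hstar ?(map_inj_uniq oppr_inj) ?uniq_Hstar //.
move=> k; rewrite -{1}[k]opprK (mem_map oppr_inj).
by rewrite !mem_Hstar inHstarN.
Qed.

(** * Extremal coordinates and congruence classes inside H_n^* *)

Lemma kmaxP (k : lat) :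
  exists2 i : 'I_4, kmax k = k i & forall j : 'I_4, k j <= k i.
Proof.
have [i _ hi] := arg_maxP k (erefl : xpredT (ord0 : 'I_4)).
have hm (j : 'I_4) : k j <= k i by apply: hi.
exists i => //; apply/eqP; rewrite eq_le; apply/andP; split.
  exact/bigmax_leP.
exact: le_bigmax.
Qed.

Lemma kminP (k : lat) :
  exists2 i : 'I_4, kmin k = k i & forall j : 'I_4, k i <= k j.
Proof.
have [i _ hi] := arg_minP k (erefl : xpredT (ord0 : 'I_4)).
have hm (j : 'I_4) : k i <= k j by apply: hi.
exists i => //; apply/eqP; rewrite eq_le; apply/andP; split.
  exact: bigmin_le.
exact/bigmin_geP.
Qed.

Lemma kmax_eq (k : lat) (i : 'I_4) : (forall j : 'I_4, k j <= k i) -> kmax k = k i.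
Proof. by have [i' -> h] := kmaxP k => hi; apply/eqP; rewrite eq_le hi h. Qed.

Lemma kmin_eq (k : lat) (i : 'I_4) : (forall j : 'I_4, k i <= k j) -> kmin k = k i.
Proof. by have [i' -> h] := kminP k => hi; apply/eqP; rewrite eq_le hi h. Qed.

Lemma le_kmax (k : lat) (i : 'I_4) : k i <= kmax k.
Proof. by have [j ->] := kmaxP k. Qed.

Lemma kmin_le (k : lat) (i : 'I_4) : kmin k <= k i.
Proof. by have [j ->] := kminP k. Qed.

Lemma kmaxN (k : lat) : kmax (- k) = - kmin k.
Proof.
have [i -> h] := kminP k; rewrite -latN; apply: kmax_eq => j.
by rewrite !latE; have := h j; lia.
Qed.

Lemma kminN (k : lat) : kmin (- k) = - kmax k.
Proof. by rewrite -{2}[k]opprK kmaxN opprK. Qed.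

Lemma inHstar_width (m : nat) (k : lat) :
  inHstar m k = inH k && (kmax k - kmin k <= (4 * m)%:Z).
Proof.
have [[i iE hi] [j jE hj]] := (kmaxP k, kminP k); rewrite iE jE.
apply/inHstarP/andP => -[-> h]; split=> // a b.
by have := hi a; have := hj b; lia.
Qed.

Lemma width_dvd4 (k : lat) : inH k -> (4 %| kmax k - kmin k)%Z.
Proof. by have [[i -> _] [j -> _]] := (kmaxP k, kminP k) => /inHP[_ /(_ i j)]. Qed.

(* On H, where coordinates sum to 0, this is congruence modulo 4n Z^4_H. *)
Definition cong (n : nat) (k l : lat) : bool :=
  [forall i : 'I_4, ((4 * n)%:Z %| k i - l i)%Z].

Lemma congP (n : nat) (k l : lat) :
  reflect (forall i : 'I_4, ((4 * n)%:Z %| k i - l i)%Z) (cong n k l).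
Proof. exact: forallP. Qed.

Lemma cong_refl (n : nat) : reflexive (cong n).
Proof. by move=> k; apply/congP => i; rewrite subrr dvdz0. Qed.

Lemma cong_sym (n : nat) : symmetric (cong n).
Proof.
by move=> k l; apply/congP/congP => h i; rewrite -opprB rpredN.
Qed.

Lemma cong_trans (n : nat) : transitive (cong n).
Proof.
move=> l k j /congP h1 /congP h2; apply/congP => i.
by rewrite -(subrK (l i) (k i)) -addrA rpredD.
Qed.

(** Descent on the sum of squares: while the spread exceeds 4n, moving 4n from a maximal coordinate
    to a minimal one stays in the class and decreases that sum. *)
Lemma cong_exists (n : nat) (a : lat) : (0 < n)%N -> inH a ->
  exists2 k, k \in Hstar n & cong n k a.
Proof.
move=> n0; have [N] := ubnP (absz (\sum_(i < 4) a i ^+ 2)).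
elim: N a => // N IH a aN aH.
have [w|w] := leP (kmax a - kmin a) (4 * n)%:Z.
  by exists a; rewrite ?cong_refl // mem_Hstar inHstar_width aH.
have [[i iE hi] [j jE hj]] := (kmaxP a, kminP a).
have ij : i != j by apply: contraTneq w; rewrite iE jE => ->; lia.
(* Coordinate [i] is maximal and [j] minimal; the transfer keeps the coordinate sum. *)
pose b : lat := [ffun l => a l + (4 * n)%:Z * ((l == j)%:Z - (l == i)%:Z)].
have bE (l : 'I_4) : b l = a l + (4 * n)%:Z * ((l == j)%:Z - (l == i)%:Z) :> int.
  exact: ffunE.
have bi : b i = a i - (4 * n)%:Z by rewrite bE eqxx (negPf ij); lia.
have bj : b j = a j + (4 * n)%:Z.
  by rewrite bE eqxx (eq_sym j) (negPf ij); lia.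
have bl (l : 'I_4) : l != i -> l != j -> b l = a l.
  by rewrite bE => /negPf-> /negPf->; lia.
have ab : cong n b a.
  by apply/congP => l; rewrite bE addrC addKr dvdz_mulr.
have bH : inH b.
  have /andP[/eqP s0 _] := aH; have /inHP[_ a4] := aH.
  apply/andP; split; last first.
    apply/forallP => x; apply/forallP => y; rewrite !bE; have := a4 x y.
    by case: (x == i); case: (x == j); case: (y == i); case: (y == j); lia.
  move: s0; rewrite (bigD1 i) //= (bigD1 j) 1?eq_sym //= => s0.
  rewrite (bigD1 i) //= (bigD1 j) 1?eq_sym //= bi bj.
  rewrite (eq_bigr (fun l => a l)); last by move=> l /andP[? ?]; apply: bl.
  by move: (\sum_(_ < _ | _) _) s0 => s s0; lia.
have [|k kS kb] := IH b _ bH; last by exists k => //; apply: cong_trans kb ab.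
move: aN; rewrite (bigD1 i) //= (bigD1 j) 1?eq_sym //=.
rewrite [X in (_ -> absz X < _)%N](bigD1 i) //=
  [X in (_ -> absz (_ + X)%R < _)%N](bigD1 j) 1?eq_sym //= bi bj.
rewrite [X in (_ -> absz (_ + (_ + X))%R < _)%N](eq_bigr (fun l => a l ^+ 2)); last first.
  by move=> l /andP[? ?]; rewrite bl.
have : 0 <= \sum_(l < 4 | (l != i) && (l != j)) a l ^+ 2.
  by apply: sumr_ge0 => l _; apply: sqr_ge0.
move: (\sum_(_ < _ | _) _) => s s0.
rewrite iE jE in w; move: (a i) (a j) w => x y w.
(* The difference of the two sides is 8n(4n - (x - y)), negative because x - y > 4n. *)
have : (x - (4 * n)%:Z) ^+ 2 + ((y + (4 * n)%:Z) ^+ 2 + s) < x ^+ 2 + (y ^+ 2 + s).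
  rewrite PoszM; move: w; rewrite PoszM; nia.
have := sqr_ge0 (x - (4 * n)%:Z); have := sqr_ge0 (y + (4 * n)%:Z).
have := sqr_ge0 x; have := sqr_ge0 y.
by lia.
Qed.

Lemma dvdz_leq (d : nat) (x : int) : (d%:Z %| x)%Z -> 0 < x -> d%:Z <= x.
Proof. by case: x => // x; rewrite dvdzE lez_nat ltz_nat => ? ?; apply: dvdn_leq. Qed.

Definition cls (n : nat) (a : lat) : seq lat := [seq k <- Hstar n | cong n k a].

Lemma cls_cong (n : nat) (k l : lat) : cong n k l -> cls n k = cls n l.
Proof.
move=> kl; apply: eq_filter => j; apply/idP/idP => h.
  exact: cong_trans h kl.
by rewrite cong_sym in kl; apply: cong_trans h kl.
Qed.

(** The zero-sum condition in [Sset] is automatic, since both points have coordinate sum 0. *)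
Lemma SsetE (n : nat) (j : lat) : inH j -> Sset n j = cls n j.
Proof.
move=> jH; apply: eq_in_filter => k; rewrite mem_Hstar => /andP[kH _].
rewrite -/(cong n k j); case: cong => //=.
have /inHP[+ _] := inHD _ _ kH (inHN _ jH); rewrite !latE => h.
by rewrite sum_ord4; apply/eqP.
Qed.

(* The difference of two congruent members of H_n^* has an entry >= 4n and an
   entry <= -4n, while its spread is at most 8n. *)
Lemma cong_boundary (n : nat) (k l : lat) :
  k \in Hstar n -> l \in Hstar n -> cong n l k -> l <> k ->
  kmax k - kmin k = (4 * n)%:Z /\
  forall i : 'I_4, [\/ l i = k i, k i = kmax k /\ l i = kmin k
                     | k i = kmin k /\ l i = kmax k].
Proof.
rewrite !mem_Hstar !inHstar_width => /andP[kH kw] /andP[lH lw] /congP lk nlk.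
have /inHP[k0 _] := kH; have /inHP[l0 _] := lH.
(* A nonzero difference with zero coordinate sum has entries of both signs. *)
have [i ip] : exists i : 'I_4, 0 < l i - k i.
  apply: contra_notP nlk => /forallNP h; apply: latP => i.
  move: (h i0) (h i1) (h i2) (h i3) => /negP ? /negP ? /negP ? /negP ?.
  by move: i; apply: ord4_ind; lia.
have [j jn] : exists j : 'I_4, l j - k j < 0.
  apply: contra_notP nlk => /forallNP h; apply: latP => i'.
  move: (h i0) (h i1) (h i2) (h i3) => /negP ? /negP ? /negP ? /negP ?.
  by move: i'; apply: ord4_ind; lia.
have pos (a : 'I_4) : 0 < l a - k a -> (4 * n)%:Z <= l a - k a.
  exact: dvdz_leq.
have neg (a : 'I_4) : l a - k a < 0 -> l a - k a <= - (4 * n)%:Z.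
  by have := @dvdz_leq (4 * n) (k a - l a); rewrite -rpredN opprB lk => /(_ isT); lia.
have bk a := conj (le_kmax k a) (kmin_le k a).
have bl a := conj (le_kmax l a) (kmin_le l a).
(* As l_i >= k_i + 4n and l_j <= k_j - 4n, the bound l_i - l_j <= 4n forces k_j - k_i >= 4n; hence
   both spreads equal 4n, and [k] and [l] share their extremal values. *)
have := (pos _ ip, neg _ jn, bk i, bk j, bl i, bl j) => -[[[[[? ?] [? ?]] [? ?]] [? ?]] [? ?]].
split=> [|a]; first lia.
case: (ltrgtP (l a - k a) 0) => ha.
- by constructor 2; have := (neg _ ha, bk a, bl a) => -[[? [? ?]] [? ?]]; lia.
- by constructor 3; have := (pos _ ha, bk a, bl a) => -[[? [? ?]] [? ?]]; lia.
- by constructor 1; lia.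
Qed.

(** A second member of the class would force spread exactly 4n, by [cong_boundary]. *)
Lemma cls_interior (n : nat) (k : lat) :
  k \in Hstar n -> kmax k - kmin k < (4 * n)%:Z -> perm_eq (cls n k) [:: k].
Proof.
move=> kS kw; apply: uniq_perm => //; first by rewrite filter_uniq ?uniq_Hstar.
move=> l; rewrite inE mem_filter; apply/andP/eqP => [[lk lS]|->].
  by have [->//|/eqP/(cong_boundary _ _ _ kS lS lk)[]] := eqVneq l k; lia.
by rewrite cong_refl.
Qed.

(* Congruent boundary points differ by a choice of which of the extremal
   coordinates are maximal. *)
Lemma size_cls_boundary (n : nat) (k : lat) : (0 < n)%N ->
  k \in Hstar n -> kmax k - kmin k = (4 * n)%:Z ->
  size (cls n k) =
    'C(#|[pred i : 'I_4 | k i == kmax k]| + #|[pred i : 'I_4 | k i == kmin k]|,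
       #|[pred i : 'I_4 | k i == kmax k]|).
Proof.
move=> n0 kS kw.
pose P := [set i : 'I_4 | k i == kmax k].
pose Q := [set i : 'I_4 | k i == kmin k].
have PE (i : 'I_4) : (i \in P) = (k i == kmax k) by rewrite inE.
have QE (i : 'I_4) : (i \in Q) = (k i == kmin k) by rewrite inE.
have -> : #|[pred i : 'I_4 | k i == kmax k]| = #|P| by rewrite cardsE.
have -> : #|[pred i : 'I_4 | k i == kmin k]| = #|Q| by rewrite cardsE.
have -> : (#|P| + #|Q|)%N = #|P :|: Q|.
  rewrite cardsU; suff -> : P :&: Q = finset.set0 by rewrite cards0 subn0.
  apply/finset.setP => i; rewrite finset.in_setI PE QE finset.in_set0; lia.
rewrite -cards_draws cardE.
have sumS (A : {set 'I_4}) : (\sum_(i < 4) (i \in A)%:Z) = #|A|%:Z.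
  rewrite -sum1_card -natz natr_sum [RHS]big_mkcond /=.
  by apply: eq_bigr => i _; case: (i \in A).
(* [g A] makes exactly the extremal coordinates in [A] maximal. It parametrises the class by the
   subsets of the extremal set [P :|: Q] having as many elements as [P]. *)
pose g (A : {set 'I_4}) : lat :=
  [ffun i => k i + (4 * n)%:Z * ((i \in A)%:Z - (i \in P)%:Z)].
have gE A (i : 'I_4) :
    g A i = k i + (4 * n)%:Z * ((i \in A)%:Z - (i \in P)%:Z) by exact: ffunE.
have g_inj : injective g.
  move=> A B /ffunP gAB; apply/finset.setP => i; have := gAB i; rewrite !gE.
  by case: (i \in A); case: (i \in B) => //; lia.
rewrite -(size_map g); apply: perm_size; apply: uniq_perm.
- by rewrite filter_uniq ?uniq_Hstar.
- by rewrite map_inj_uniq ?enum_uniq.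
move: (kS); rewrite mem_Hstar inHstar_width => /andP[kH _].
have /andP[/eqP k0 _] := kH; have /inHP[_ k4] := kH.
move=> l; rewrite mem_filter; apply/andP/mapP => [[lk lS]|[A + ->]].
  move: (lS); rewrite mem_Hstar => /andP[/andP[/eqP l0 _] _].
  have lkP (i : 'I_4) : [\/ l i = k i, k i = kmax k /\ l i = kmin k
                     | k i = kmin k /\ l i = kmax k].
    have [->|/eqP/(cong_boundary _ _ _ kS lS lk)[_]] := eqVneq l k; last exact.
    by constructor 1.
  pose A := [set i in P :|: Q | l i == kmax k].
  have lgA : l = g A.
    apply: latP => i; rewrite gE inE finset.in_setU PE QE.
    have [h|[h h']|[h h']] := lkP i; rewrite ?h ?h'.
    - by case: (k i =P kmax k); case: (k i =P kmin k) => //=; lia.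
    - by case: eqP; case: eqP => //=; lia.
    - by case: eqP; case: eqP; case: eqP => //=; lia.
  exists A => //; rewrite mem_enum inE; apply/andP; split.
    by apply/fintype.subsetP => i; rewrite inE => /andP[].
  (* The zero coordinate sum of [l] is what forces [A] and [P] to have equal size. *)
  move: l0; rewrite lgA (eq_bigr (fun i => k i + (4 * n)%:Z * ((i \in A)%:Z - (i \in P)%:Z)))
    => [|i _]; last exact: gE.
  rewrite big_split /= k0 add0r -big_distrr /= sumrB !sumS => /eqP.
  by rewrite mulf_eq0 subr_eq0 eqz_nat => /orP[|//]; lia.
rewrite mem_enum inE => /andP[/fintype.subsetP AE /eqP cA].
have bg (i : 'I_4) : kmin k <= g A i <= kmax k.
  rewrite gE; have := (le_kmax k i, kmin_le k i) => -[].
  have := AE i; rewrite finset.in_setU PE QE; case: (i \in A) => [/(_ isT)|_].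
    by case/orP => /eqP ->; case: eqP; lia.
  by case: eqP; lia.
split; first by apply/congP => i; rewrite gE addrC addKr dvdz_mulr.
rewrite mem_Hstar inHstar_width; apply/andP; split; last first.
  have [[i -> _] [j -> _]] := (kmaxP (g A), kminP (g A)).
  by have := bg i; have := bg j; lia.
apply/andP; split.
  rewrite (eq_bigr (fun i => k i + (4 * n)%:Z * ((i \in A)%:Z - (i \in P)%:Z)))
    => [|i _]; last exact: gE.
  by rewrite big_split /= k0 -big_distrr /= sumrB !sumS cA subrr mulr0.
apply/forallP => i; apply/forallP => j; rewrite !gE; have := k4 i j.
by case: (i \in A); case: (i \in P); case: (j \in A); case: (j \in P); lia.
Qed.

(** * Total weight of a congruence class *)

Section Weights.
Variable R : realType.

Lemma coef_cls (n : nat) (k : lat) : (0 < n)%N -> k \in Hstar n ->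
  coef R n k = (size (cls n k))%:R^-1.
Proof.
move=> n0 kS; rewrite /coef; case: ltP => kw.
  by rewrite (perm_size (cls_interior _ _ kS kw)) invr1.
rewrite size_cls_boundary // ?div1r //; move: kS.
by rewrite mem_Hstar inHstar_width => /andP[_]; lia.
Qed.

(** By [coef_cls] the coefficient is constant on a class, equal to the reciprocal of its size;
    [cong_exists] ensures that the size is not 0. *)
Lemma sum_coef (n : nat) (a : lat) : (0 < n)%N -> inH a ->
  \sum_(k <- Hstar n | cong n k a) coef R n k = 1.
Proof.
move=> n0 aH; rewrite -big_filter -/(cls n a) big_seq.
rewrite (eq_bigr (fun=> (size (cls n a))%:R^-1)) => [|k]; last first.
  by rewrite mem_filter => /andP[/cls_cong ca kS]; rewrite coef_cls // ca.
rewrite -big_seq big_const_seq count_predT iter_addr_0 -[LHS]mulr_natr mulVf //.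
have [k kS ka] := cong_exists _ _ n0 aH.
by rewrite pnatr_eq0 -lt0n -has_predT; apply/hasP; exists k => //; rewrite mem_filter ka.
Qed.

End Weights.

(** * Characters of H modulo 4n Z^4_H *)

Section Characters.
Variable R : realType.

Definition expi (x : R) : R[i] := cos x +i* sin x.

Lemma expiD (x y : R) : expi (x + y) = expi x * expi y.
Proof.
by apply/eqP; rewrite eq_complex /= cosD sinD addrC [sin x * _ + _]addrC !eqxx.
Qed.

Lemma expi0 : expi 0 = 1.
Proof. by rewrite /expi cos0 sin0. Qed.

Lemma expiMn (x : R) (n : nat) : expi (x * n%:R) = expi x ^+ n.
Proof.
elim: n => [|n IH]; first by rewrite mulr0 expi0.
by rewrite -natr1 mulrDr mulr1 expiD IH exprSr.
Qed.

Lemma expi2pi : expi (2 * pi) = 1.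
Proof. by rewrite /expi mulr_natl cos2pi sin2pi. Qed.

Lemma expi_int (z : int) : expi (2 * pi * z%:~R) = 1.
Proof.
have h (n : nat) : expi (2 * pi * n%:R) = 1 by rewrite expiMn expi2pi expr1n.
case: z => n; first exact: h.
rewrite NegzE intrN -pmulrn mulrN -[LHS]mulr1 -[X in _ * X](h n.+1) -expiD addNr.
exact: expi0.
Qed.

(** The half-angle formula cos x = 1 - 2 sin(x/2)^2 applies, with sin(x/2) > 0 on this interval. *)
Lemma expi_neq1 (x : R) : 0 < x < 2 * pi -> expi x <> 1.
Proof.
move=> /andP[x0 x2] /eqP; rewrite eq_complex => /andP[/eqP /= c1 _].
have : 0 < sin (x / 2) by apply: sin_gt0_pi; lra.
have : cos x = 1 - 2 * sin (x / 2) ^+ 2.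
  rewrite {1}(_ : x = x / 2 + x / 2); last by field.
  rewrite cosD; have := cos2Dsin2 (x / 2); lra.
rewrite c1; nra.
Qed.

Lemma sum_expi_geom (N : nat) (y : int) : (0 < N)%N ->
  \sum_(i < N) expi (2 * pi * (y%:~R / N%:R)) ^+ i =
  if (N%:Z %| y)%Z then N%:R else 0.
Proof.
move=> N0; have N0' : (N%:R : R) != 0 by rewrite pnatr_eq0 -lt0n.
have NZ0 : N%:Z != 0 by lia.
set z := expi _.
(* Replacing [y] by its residue brings the angle into [0, 2 pi), where [expi_neq1] decides whether z
   = 1. *)
have zE : z = expi (2 * pi * ((y %% N%:Z)%Z%:~R / N%:R)).
  rewrite /z {1}(divz_eq y N%:Z) intrD intrM [(_ + _) / _]mulrDl [_ * (_ + _)]mulrDr expiD.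
  by rewrite -pmulrn mulfK // expi_int mul1r.
case: ifPn => [/dvdz_mod0P yN|/dvdz_mod0P yN].
  rewrite zE yN mul0r mulr0 expi0 (eq_bigr (fun=> 1)) => [|i _]; last by rewrite expr1n.
  by rewrite sumr_const card_ord.
have /eqP z1 : z <> 1.
  have := modz_ge0 y NZ0; have := ltz_mod y NZ0; rewrite zE.
  case: (y %% N%:Z)%Z yN => // m m0 mN _; apply: expi_neq1.
  have pi0 := pi_gt0 R; have m0' : (0 < m)%N by lia.
  rewrite -pmulrn mulr_gt0 ?mulr_gt0 ?invr_gt0 ?ltr0n //=.
  rewrite gtr_pMr ?mulr_gt0 // ltr_pdivrMr ?ltr0n // mul1r ltr_nat; lia.
(* Multiplied by z - 1, the geometric sum becomes z^N - 1 = 0. *)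
apply/eqP; rewrite -(inj_eq (mulfI (_ : z - 1 != 0))) ?subr_eq0 // mulr0 -subrX1.
by rewrite subr_eq0 -expiMn -mulrA divfK // expi_int.
Qed.

Lemma phiE (k : lat) (t : pt R) :
  phi k t = expi (pi / 2 * \sum_(i < 4) (k i)%:~R * t i).
Proof. by []. Qed.

Lemma phiD (k l : lat) (t : pt R) : phi (k + l) t = phi k t * phi l t.
Proof.
rewrite !phiE -expiD -mulrDr -big_split /=; congr (expi (_ * _)).
by apply: eq_bigr => i _; rewrite latD intrD mulrDl.
Qed.

Lemma phiDr (k : lat) (s t : pt R) : phi k (fun i => s i + t i) = phi k s * phi k t.
Proof.
rewrite !phiE -expiD -mulrDr -big_split /=; congr (expi (_ * _)).
by apply: eq_bigr => i _; rewrite mulrDr.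
Qed.

Lemma pt_ofB (n : nat) (k l : lat) :
  (fun i => pt_of R n k i - pt_of R n l i) = pt_of R n (k - l).
Proof. by apply: funext => i; rewrite /pt_of !latE intrD intrN mulrBl. Qed.

(** Write k - l = 4n d with d of sum 0, and x_i = x_0 + 4 y_i. The phase difference is (pi/2) d.x,
    in which x_0 cancels, leaving 2 pi times the integer d_1 y_1 + d_2 y_2 + d_3 y_3. *)
Lemma phi_cong (n : nat) (x k l : lat) : (0 < n)%N -> inH x -> inH k -> inH l ->
  cong n k l -> phi k (pt_of R n x) = phi l (pt_of R n x).
Proof.
move=> n0 /inHP[_ x4] kH lH /congP kl.
have n0' : (n%:R : R) != 0 by rewrite pnatr_eq0 -lt0n.
rewrite -(subrK l k) phiD -[RHS]mul1r; congr (_ * _).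
have /inHP[+ _] := inHD _ _ kH (inHN _ lH).
have q (i : 'I_4) : exists y : int, (k - l) i = y * (4 * n)%:Z.
  by rewrite !latE; apply/dvdzP; exact: kl.
have [[d0 e0] [d1 e1] [d2 e2] [d3 e3]] := And4 (q i0) (q i1) (q i2) (q i3).
rewrite e0 e1 e2 e3 => s0.
have {}s0 : d0 + d1 + d2 + d3 = 0.
  have : (d0 + d1 + d2 + d3) * (4 * n)%:Z = 0 by rewrite !mulrDl.
  by move/eqP; rewrite mulf_eq0 => /orP[/eqP//|]; lia.
have [[y1 f1] [y2 f2] [y3 f3]] :
  [/\ exists y : int, x i1 = x i0 + y * 4, exists y : int, x i2 = x i0 + y * 4
    & exists y : int, x i3 = x i0 + y * 4].
  have h i : exists y : int, x i = x i0 + y * 4.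
    by have /dvdzP[y yE] := x4 i i0; exists y; lia.
  by split.
rewrite phiE -(expi_int (d1 * y1 + d2 * y2 + d3 * y3)); congr expi.
rewrite /pt_of sum_ord4 e0 e1 e2 e3 f1 f2 f3 (_ : d0 = - (d1 + d2 + d3)); last by lia.
by rewrite !(intrD, intrM, intrN) /= -!pmulrn natrM; field.
Qed.

Definition lat4 (x y z w : int) : lat := [ffun i : 'I_4 => nth 0 [:: x; y; z; w] i].

Lemma lat4E x y z w : [/\ lat4 x y z w i0 = x, lat4 x y z w i1 = y,
  lat4 x y z w i2 = z & lat4 x y z w i3 = w].
Proof. by split; apply: ffunE. Qed.

(* A transversal of H modulo 4n Z^4_H, linear in the parameters, so that a
   character sum over it is a product of three geometric sums. *)
Definition fdom (n : nat) (a : 'I_(4 * n) * 'I_n * 'I_n) : lat :=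
  let: (x, b, c) := a in
  lat4 x%:Z (x + 4 * b)%:Z (x + 4 * c)%:Z (- (3 * x + 4 * b + 4 * c)%:Z).

Lemma fdom_inH (n : nat) a : inH (fdom n a).
Proof.
case: a => [[x b] c]; rewrite /fdom; set X := x%:Z.
have [e0 e1 e2 e3] := lat4E X (x + 4 * b)%:Z (x + 4 * c)%:Z (- (3 * x + 4 * b + 4 * c)%:Z).
apply/inHP; split; first by rewrite e0 e1 e2 e3; lia.
apply: ord4_ind; apply: ord4_ind; rewrite ?e0 ?e1 ?e2 ?e3 /X; lia.
Qed.

Lemma dvdz_sub_ord (d : nat) (z : int) : (0 < d)%N ->
  exists a0 : 'I_d, forall a : 'I_d, (d%:Z %| z - a%:Z)%Z = (a == a0).
Proof.
move=> d0; have dz : d%:Z != 0 by lia.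
have m0 := modz_ge0 z dz; have md := ltz_mod z dz.
have lt : (absz (z %% d%:Z)%Z < d)%N by lia.
exists (Ordinal lt) => a; rewrite -eqz_mod_dvd (modz_small (m := a%:Z)) ?ltz_nat ?ltn_ord //.
by apply/eqP/eqP => [h|->]; [apply: val_inj => /=|rewrite /=]; lia.
Qed.

(** The parameters are read off from [k]: x is k_0 modulo 4n, while b and c are (k_1 - k_0)/4 and
    (k_2 - k_0)/4 modulo n. The last coordinate follows from the zero sum. *)
Lemma cong_fdom (n : nat) (k : lat) : (0 < n)%N -> inH k ->
  exists a0, forall a, cong n k (fdom n a) = (a == a0).
Proof.
move=> n0 kH; have /inHP[k0 k4] := kH.
have [y1 y1E] : exists y : int, k i1 - k i0 = y * 4 by apply/dvdzP; exact: k4.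
have [y2 y2E] : exists y : int, k i2 - k i0 = y * 4 by apply/dvdzP; exact: k4.
have n4 : (0 < 4 * n)%N by lia.
have [x0 x0P] := dvdz_sub_ord _ (k i0) n4.
have [b0 b0P] := dvdz_sub_ord _ y1 n0.
have [c0 c0P] := dvdz_sub_ord _ y2 n0.
exists (x0, b0, c0) => -[[x b] c]; rewrite !xpair_eqE -x0P -b0P -c0P.
rewrite /fdom; set X := x%:Z.
have [e0 e1 e2 e3] := lat4E X (x + 4 * b)%:Z (x + 4 * c)%:Z (- (3 * x + 4 * b + 4 * c)%:Z).
have d4 z : (n%:Z %| z)%Z = ((4 * n)%:Z %| 4 * z)%Z.
  by rewrite PoszM dvdz_mul2l.
rewrite !d4.
have -> : 4 * (y1 - b%:Z) = k i1 - (x + 4 * b)%:Z - (k i0 - X) by rewrite /X; lia.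
have -> : 4 * (y2 - c%:Z) = k i2 - (x + 4 * c)%:Z - (k i0 - X) by rewrite /X; lia.
apply/congP/andP => [h|[/andP[h0 h1] h2]].
  have := (h i0, h i1, h i2); rewrite e0 e1 e2 => -[[h0 h1] h2].
  by split; [rewrite h0 /=|]; apply: rpredB.
have h1' := rpredD h1 h0; have h2' := rpredD h2 h0; rewrite !subrK in h1' h2'.
apply: ord4_ind; rewrite ?e0 ?e1 ?e2 ?e3 //.
have -> : k i3 - - (3 * x + 4 * b + 4 * c)%:Z =
  - (k i0 - X + (k i1 - (x + 4 * b)%:Z) + (k i2 - (x + 4 * c)%:Z)) by rewrite /X; lia.
by rewrite rpredN; apply: rpredD => //; apply: rpredD.
Qed.

(** Grouping H_n^* by classes, each represented once by [fdom], leaves the total weight 1 of each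
    class as a factor. *)
Lemma sum_Hstar_fdom (n : nat) (g : lat -> R[i]) : (0 < n)%N ->
  (forall k l, inH k -> inH l -> cong n k l -> g k = g l) ->
  \sum_(k <- Hstar n) (coef R n k)%:C * g k = \sum_a g (fdom n a).
Proof.
move=> n0 gP; transitivity
  (\sum_a \sum_(k <- Hstar n | cong n k (fdom n a)) (coef R n k)%:C * g k).
  rewrite (exchange_big_dep xpredT) //=; apply: eq_big_seq => k.
  rewrite mem_Hstar => /andP[kH _]; have [a0 a0P] := cong_fdom _ _ n0 kH.
  by rewrite (eq_bigl (pred1 a0)) ?big_pred1_eq.
apply: eq_bigr => a _; rewrite -[RHS]mul1r.
have -> : (1 : R[i]) = (1 : R)%:C by [].
rewrite -(sum_coef R _ _ n0 (fdom_inH n a)) rmorph_sum mulr_suml.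
rewrite big_seq_cond [RHS]big_seq_cond; apply: eq_bigr => k /andP[].
by rewrite mem_Hstar => /andP[kH _] ka; rewrite (gP k (fdom n a)) ?fdom_inH.
Qed.

(** Since x_0 + x_1 + x_2 - 3 x_3 = -4 x_3, the dot product with the representative is -4a x_3 + 4b
    (x_1 - x_3) + 4c (x_2 - x_3), so the character splits into three powers. *)
Lemma phi_fdom (n : nat) (x : lat) (y1 y2 : int) a : (0 < n)%N -> inH x ->
  x i1 - x i3 = y1 * 4 -> x i2 - x i3 = y2 * 4 ->
  phi (fdom n a) (pt_of R n x) =
  expi (2 * pi * ((- x i3)%:~R / (4 * n)%:R)) ^+ a.1.1 *
  (expi (2 * pi * (y1%:~R / n%:R)) ^+ a.1.2 * expi (2 * pi * (y2%:~R / n%:R)) ^+ a.2).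
Proof.
move=> n0 /inHP[x0 _] e1 e2; case: a => [[a b] c].
have n0' : (n%:R : R) != 0 by rewrite pnatr_eq0 -lt0n.
rewrite -!expiMn -!expiD phiE; congr expi.
rewrite /pt_of sum_ord4.
have [-> -> -> ->] := lat4E a%:Z (a + 4 * b)%:Z (a + 4 * c)%:Z (- (3 * a + 4 * b + 4 * c)%:Z).
have -> : x i0 = - (3 * x i3 + y1 * 4 + y2 * 4) by lia.
have -> : x i1 = x i3 + y1 * 4 by lia.
have -> : x i2 = x i3 + y2 * 4 by lia.
by rewrite !(intrD, intrM, intrN) /= -!pmulrn !(natrD, natrM); field.
Qed.

(** The three geometric sums equal 4n, n and n, or one of them vanishes; their product cancels the
    factor 1/(4 n^3) exactly when [x] is congruent to 0. *)
Lemma Phistar_delta (n : nat) (x : lat) : (0 < n)%N -> inH x ->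
  Phistar n (pt_of R n x) = (cong n x 0)%:R.
Proof.
move=> n0 xH; have /inHP[x0 x4] := xH.
have [y1 y1E] : exists y : int, x i1 - x i3 = y * 4 by apply/dvdzP; exact: x4.
have [y2 y2E] : exists y : int, x i2 - x i3 = y * 4 by apply/dvdzP; exact: x4.
rewrite /Phistar sum_Hstar_fdom // => [|k l kH lH kl]; last exact: phi_cong.
rewrite (eq_bigr _ (fun a _ => phi_fdom _ _ _ _ a n0 xH y1E y2E)).
rewrite -(pair_bigA _ (fun (p : 'I_(4 * n) * 'I_n) (c : 'I_n) =>
  expi (2 * pi * ((- x i3)%:~R / (4 * n)%:R)) ^+ p.1 *
  (expi (2 * pi * (y1%:~R / n%:R)) ^+ p.2 * expi (2 * pi * (y2%:~R / n%:R)) ^+ c))) /=.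
rewrite -(pair_bigA _ (fun (a : 'I_(4 * n)) (b : 'I_n) => \sum_(c < n)
  expi (2 * pi * ((- x i3)%:~R / (4 * n)%:R)) ^+ a *
  (expi (2 * pi * (y1%:~R / n%:R)) ^+ b * expi (2 * pi * (y2%:~R / n%:R)) ^+ c))) /=.
under eq_bigr do under eq_bigr do rewrite -!big_distrr.
under eq_bigr do rewrite -big_distrr -big_distrl.
rewrite -big_distrl /= !sum_expi_geom ?muln_gt0 // rpredN.
have d4 z : (n%:Z %| z)%Z = ((4 * n)%:Z %| z * 4)%Z.
  by rewrite PoszM [_ * 4]mulrC dvdz_mul2l.
rewrite !d4 -y1E -y2E.
(* The three divisibility conditions cover x_3, x_1 and x_2; x_0 follows from the zero sum. *)
have -> : cong n x 0 = [&& ((4 * n)%:Z %| x i3)%Z, ((4 * n)%:Z %| x i1 - x i3)%Z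
    & ((4 * n)%:Z %| x i2 - x i3)%Z].
  have z (i : 'I_4) : (0 : lat) i = 0 by exact: ffunE.
  apply/congP/and3P => [h|[h3 h1 h2]].
    by have := (h i1, h i2, h i3); rewrite !z !subr0 => -[[h1 h2] h3]; split=> //; apply: rpredB.
  have {}h1 := rpredD h1 h3; have {}h2 := rpredD h2 h3; rewrite !subrK in h1 h2.
  apply: ord4_ind; rewrite z subr0 //.
  have -> : x i0 = - (x i1 + x i2 + x i3) by lia.
  by rewrite rpredN; apply: rpredD => //; apply: rpredD.
have n0' : (n%:R : R[i]) != 0 by rewrite pnatr_eq0 -lt0n.
case: ifP => _; case: ifP => _; case: ifP => _; rewrite ?mulr0 ?mul0r ?mulr0 //=.
rewrite rmorphM rmorph1 mul1r.
rewrite fmorphV rmorph_nat natrM natrX.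
by field.
Qed.

(** * Interpolation at the nodes and membership in T_n *)

Lemma ell_delta (n : nat) (k j : lat) : (0 < n)%N -> inH k -> inH j ->
  ell n j (pt_of R n k) = (cong n k j)%:R.
Proof.
move=> n0 kH jH; rewrite /ell pt_ofB Phistar_delta ?inHD ?inHN //.
congr (_%:R); congr nat_of_bool; apply: eq_forallb => i.
by rewrite !latE (_ : (0 : lat) i = 0) ?subr0 //; exact: ffunE.
Qed.

Lemma Interp_node (n : nat) (f : pt R -> R[i]) (j : lat) : (0 < n)%N -> inH j ->
  Interp n f (pt_of R n j) = \sum_(k <- cls n j) f (pt_of R n k).
Proof.
move=> n0 jH; rewrite /Interp /cls [RHS]big_filter [RHS]big_mkcond /=.
rewrite big_seq [RHS]big_seq; apply: eq_bigr => k.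
rewrite mem_Hstar => /andP[kH _]; rewrite ell_delta // cong_sym.
by case: cong; rewrite ?mulr1 ?mulr0.
Qed.

Lemma Interp_inTn (n : nat) (f : pt R -> R[i]) : inTn n (Interp n f).
Proof.
(* These coefficients come from splitting phi_k(t - j/(4n)) as phi_k(t) phi_k(-j/(4n)) and
   exchanging the two sums. *)
exists (fun k => \sum_(j <- Hstar n) f (pt_of R n j) * ((1 / (4 * n ^ 3)%:R)%:C *
  ((coef R n k)%:C * phi k (pt_of R n (- j))))) => t _.
under [RHS]eq_bigr do rewrite mulr_suml.
rewrite exchange_big; apply: eq_bigr => j _.
rewrite /ell /Phistar; under [RHS]eq_bigr do rewrite -!mulrA.
rewrite -!mulr_sumr; congr (_ * (_ * _)); apply: eq_bigr => k _.
congr (_ * _); rewrite mulrC -phiDr; congr phi; apply: funext => i.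
by rewrite /pt_of latN intrN mulNr.
Qed.

Lemma inHcirc_width (n : nat) (k : lat) : (0 < n)%N ->
  inHcirc n k = inH k && (kmax k - kmin k < (4 * n)%:Z).
Proof.
move=> n0; have [[i iE hi] [j jE hj]] := (kmaxP k, kminP k); rewrite iE jE.
apply/andP/andP => -[-> h]; split=> //.
  (* [inHcirc] says nothing about equal indices; there the spread is 0, below 4n because n > 0. *)
  have [->|ij] := eqVneq i j; first by lia.
  by have /forallP/(_ i)/forallP/(_ j)/implyP/(_ ij)/andP[] := h.
apply/forallP => a; apply/forallP => b; apply/implyP => _.
by have := (hi a, hi b, hj a, hj b) => -[[[]]]; lia.
Qed.

End Characters.

(** * Boundary points of H_n^* by number of extremal coordinates *)

Lemma sum_eq_ord4 (j : 'I_4) : \sum_(i < 4) (i == j)%:Z = 1.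
Proof. by move: j; apply: ord4_ind; rewrite sum_ord4. Qed.

(** Supplies a minimal coordinate for the explicit boundary points, whose profiles are nonzero at no
    more than two indices. *)
Lemma third_ord4 (x y : 'I_4) : exists2 z : 'I_4, z != x & z != y.
Proof.
move: x y; apply: ord4_ind; apply: ord4_ind;
  by [exists i0 | exists i1 | exists i2 | exists i3].
Qed.

(** A boundary point is encoded by its profile [e] of heights above the minimum; taking [c] as a
    quarter of the sum of [e] moves it into the zero-sum hyperplane. *)
Definition shifted (e : 'I_4 -> int) (c : int) : lat := [ffun i => e i - c].

Lemma shiftedE (e : 'I_4 -> int) (c : int) (i : 'I_4) : shifted e c i = e i - c.
Proof. exact: ffunE. Qed.

Lemma shifted_boundary (n : nat) (e : 'I_4 -> int) (c : int) (x y : 'I_4) :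
  e x = (4 * n)%:Z -> e y = 0 -> (forall i, 0 <= e i <= (4 * n)%:Z) ->
  (forall i, (4 %| e i)%Z) -> \sum_(i < 4) e i = c * 4 ->
  [/\ shifted e c \in Hstar n, kmax (shifted e c) = (4 * n)%:Z - c
    & kmin (shifted e c) = - c].
Proof.
move=> ex ey eb e4 es.
have M : kmax (shifted e c) = (4 * n)%:Z - c.
  rewrite -ex -shiftedE; apply: kmax_eq => j; rewrite !shiftedE.
  by have := eb j; lia.
have m : kmin (shifted e c) = - c.
  rewrite -[- c]add0r -ey -shiftedE; apply: kmin_eq => j; rewrite !shiftedE.
  by have := eb j; lia.
split=> //; rewrite mem_Hstar inHstar_width M m; apply/andP; split; last by lia.
apply/inHP; split=> [|i j]; rewrite !shiftedE; first by rewrite sum_ord4 in es; lia.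
by have := e4 i; have := e4 j; lia.
Qed.

Lemma shifted_unique (k : lat) (e : 'I_4 -> int) (c : int) :
  inH k -> (forall i : 'I_4, k i = kmin k + e i) -> \sum_(i < 4) e i = c * 4 ->
  k = shifted e c.
Proof.
move=> /inHP[k0 _] ke; rewrite sum_ord4 => es.
have kc : kmin k = - c by have := (ke i0, ke i1, ke i2, ke i3) => -[[[]]]; lia.
by apply: latP => i; rewrite shiftedE ke kc addrC.
Qed.

Section Types.
Variables (a b : 'I_4 -> bool).

(* For [a i], [b i] meaning that coordinate [i] is maximal, resp. minimal:
   [typePQ a b] says that P coordinates are maximal and Q minimal, and
   [typePQ b a] the reverse. *)
Definition type12 (v j : 'I_4) : bool :=
  [&& j != v, ~~ a v, ~~ b v, a j & [forall i : 'I_4, (i != v) && (i != j) ==> b i]].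
Definition type13 (j : 'I_4) : bool :=
  a j && [forall i : 'I_4, (i != j) ==> b i].
Definition type22 (u v : 'I_4) : bool :=
  [&& (u < v)%N, a u, a v & [forall i : 'I_4, (i != u) && (i != v) ==> b i]].
End Types.

Lemma forall_ord4 (P : pred 'I_4) : [forall i : 'I_4, P i] = [&& P i0, P i1, P i2 & P i3].
Proof.
apply/forallP/and4P => [h|[]]; first by split.
by move=> *; apply: (ord4_ind (fun i => P i)).
Qed.

Lemma card_ord4 (P : pred 'I_4) : #|[pred i : 'I_4 | P i]| = (P i0 + P i1 + P i2 + P i3)%N.
Proof.
rewrite -sum1_card big_mkcond /= sum_ord4 /= !inE /=.
by case: (P i0); case: (P i1); case: (P i2); case: (P i3).
Qed.

(* 1 / 'C(p + q, p) = 1/2 - n12/6 - n13/4 - n22/3 with denominators cleared. *)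
Lemma bin_types (a b : 'I_4 -> bool) (p q n12 n13 n22 : nat) (x y : 'I_4) :
  (forall i, ~~ (a i && b i)) -> a x -> b y ->
  p = #|[pred i : 'I_4 | a i]| -> q = #|[pred i : 'I_4 | b i]| ->
  n12 = (\sum_(v < 4) \sum_(j < 4) (type12 a b v j + type12 b a v j))%N ->
  n13 = (\sum_(j < 4) (type13 a b j + type13 b a j))%N ->
  n22 = (\sum_(u < 4) \sum_(v < 4) type22 a b u v)%N ->
  ('C(p + q, p) * 6 == 12 + 'C(p + q, p) * (2 * n12 + 3 * n13 + 4 * n22))%N.
Proof.
move=> ab ax by_ -> -> -> -> ->; rewrite !card_ord4.
have {ax}: [|| a i0, a i1, a i2 | a i3].
  by move: x ax; apply: ord4_ind => ->; rewrite ?orbT.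
have {by_}: [|| b i0, b i1, b i2 | b i3].
  by move: y by_; apply: ord4_ind => ->; rewrite ?orbT.
move: (ab i0) (ab i1) (ab i2) (ab i3) => {ab}.
rewrite !sum_ord4 /type12 /type13 /type22 !forall_ord4 /=.
(* What remains is a check of all 256 truth assignments. *)
move: (a i0) (a i1) (a i2) (a i3) (b i0) (b i1) (b i2) (b i3).
by do 8!case.
Qed.

Definition onbd (n : nat) (k : lat) : bool := kmax k - kmin k == (4 * n)%:Z.
Definition ismax (k : lat) (i : 'I_4) : bool := k i == kmax k.
Definition ismin (k : lat) (i : 'I_4) : bool := k i == kmin k.

Lemma ismaxN (k : lat) : ismax (- k) = ismin k.
Proof. by apply: funext => i; rewrite /ismax kmaxN latN eqr_opp. Qed.

Lemma isminN (k : lat) : ismin (- k) = ismax k.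
Proof. by apply: funext => i; rewrite /ismin kminN latN eqr_opp. Qed.

Lemma onbdN (n : nat) (k : lat) : onbd n (- k) = onbd n k.
Proof. by rewrite /onbd kmaxN kminN opprK addrC. Qed.

(** Only one orientation of each pattern is named; the one with maxima and minima exchanged is the
    same predicate at [- k]. *)
Definition bd12 n v j k := onbd n k && type12 (ismax k) (ismin k) v j.
Definition bd13 n j k := onbd n k && type13 (ismax k) (ismin k) j.
Definition bd22 n u v k := onbd n k && type22 (ismax k) (ismin k) u v.

Definition k12 (n : nat) (v j : 'I_4) (s : nat) : lat :=
  shifted (fun i => (i == j)%:Z * (4 * n)%:Z + (i == v)%:Z * (4 * s)%:Z) (n + s)%:Z.
Definition k13 (n : nat) (j : 'I_4) : lat :=
  shifted (fun i => (i == j)%:Z * (4 * n)%:Z) n%:Z.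
Definition k22 (n : nat) (u v : 'I_4) : lat :=
  shifted (fun i => (i == u)%:Z * (4 * n)%:Z + (i == v)%:Z * (4 * n)%:Z) (2 * n)%:Z.

(** Coordinate [v] is not extremal and lies at a multiple of 4 above the minimum, so its height is
    4s with 1 <= s <= n - 1. This is the arithmetic progression behind the sine quotient. *)
Lemma perm_bd12 (n : nat) (v j : 'I_4) : j != v ->
  perm_eq [seq k <- Hstar n | bd12 n v j k] (map (k12 n v j) (index_iota 1 n)).
Proof.
move=> jv; have vj : v != j by rewrite eq_sym.
have es (s : nat) : \sum_(i < 4) ((i == j)%:Z * (4 * n)%:Z + (i == v)%:Z * (4 * s)%:Z)
    = (n + s)%:Z * 4.
  by rewrite big_split /= -!big_distrl /= !sum_eq_ord4; lia.
apply: uniq_perm; first by rewrite filter_uniq ?uniq_Hstar.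
  rewrite map_inj_uniq ?iota_uniq // => s s' /(congr1 (fun k : lat => k v : int)).
  by rewrite !shiftedE eqxx (negPf vj); lia.
move=> k; rewrite mem_filter; apply/andP/mapP.
  case=> /andP[/eqP kw /and5P[_ av bv /eqP aj /forallP h]].
  rewrite mem_Hstar => /andP[kH _].
  have [i kmi _] := kminP k; have /inHP[_ k4] := kH.
  have := k4 v i; have := le_kmax k v; have := kmin_le k v.
  have := av; have := bv; rewrite /ismax /ismin -{}kmi => bv' av' ? ? /dvdzP[y yE].
  exists (absz y); first by rewrite mem_index_iota; lia.
  apply: shifted_unique (es _) => // l; have := h l.
  have [->|_] := eqVneq l j; first by rewrite (negPf jv); lia.
  have [->|_ /eqP ->] := eqVneq l v; lia.
case=> s; rewrite mem_index_iota => sn ->.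
have [z zv zj] := third_ord4 v j.
have [kS kM km] : [/\ k12 n v j s \in Hstar n, kmax (k12 n v j s) = (4 * n)%:Z - (n + s)%:Z
    & kmin (k12 n v j s) = - (n + s)%:Z].
  apply: (@shifted_boundary _ _ _ j z); last exact: es.
  - by rewrite eqxx (negPf jv); lia.
  - by rewrite (negPf zv) (negPf zj).
  - by move=> i; have [->|_] := eqVneq i j; rewrite ?(negPf jv); case: (i == v); lia.
  - by move=> i; case: (i == j); case: (i == v); lia.
split=> //; rewrite /bd12 /onbd /type12 /ismax /ismin kM km jv !shiftedE eqxx.
rewrite !(eqxx, negPf jv, negPf vj) /=; apply/andP; split; first by lia.
apply/and4P; split; try by lia.
by apply/forallP => i; apply/implyP => /andP[/negPf iv /negPf ij]; rewrite shiftedE iv ij; lia.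
Qed.

Lemma perm_bd13 (n : nat) (j : 'I_4) : (0 < n)%N ->
  perm_eq [seq k <- Hstar n | bd13 n j k] [:: k13 n j].
Proof.
move=> n0; have es : \sum_(i < 4) ((i == j)%:Z * (4 * n)%:Z) = n%:Z * 4.
  by rewrite -!big_distrl /= !sum_eq_ord4; lia.
apply: uniq_perm => //; first by rewrite filter_uniq ?uniq_Hstar.
move=> k; rewrite mem_filter inE; apply/andP/eqP.
  case=> /andP[/eqP kw /andP[/eqP aj /forallP h]].
  rewrite mem_Hstar => /andP[kH _].
  apply: shifted_unique es => // l; have := h l.
  by have [->|_ /eqP ->] := eqVneq l j; lia.
move=> ->; have [z zj _] := third_ord4 j j.
have [kS kM km] : [/\ k13 n j \in Hstar n, kmax (k13 n j) = (4 * n)%:Z - n%:Z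
    & kmin (k13 n j) = - n%:Z].
  apply: (@shifted_boundary _ _ _ j z); last exact: es.
  - by rewrite eqxx; lia.
  - by rewrite (negPf zj).
  - by move=> i; case: (i == j); lia.
  - by move=> i; case: (i == j); lia.
split=> //; rewrite /bd13 /onbd /type13 /ismax /ismin kM km !shiftedE eqxx.
apply/and3P; split; try by lia.
by apply/forallP => i; apply/implyP => /negPf ij; rewrite shiftedE ij; lia.
Qed.

Lemma perm_bd22 (n : nat) (u v : 'I_4) : (0 < n)%N -> (u < v)%N ->
  perm_eq [seq k <- Hstar n | bd22 n u v k] [:: k22 n u v].
Proof.
move=> n0 luv; have uv : u != v by rewrite -(inj_eq val_inj) ltn_eqF.
have vu : v != u by rewrite eq_sym.
have es : \sum_(i < 4) ((i == u)%:Z * (4 * n)%:Z + (i == v)%:Z * (4 * n)%:Z) = (2 * n)%:Z * 4.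
  by rewrite big_split /= -!big_distrl /= !sum_eq_ord4; lia.
apply: uniq_perm => //; first by rewrite filter_uniq ?uniq_Hstar.
move=> k; rewrite mem_filter inE; apply/andP/eqP.
  case=> /andP[/eqP kw /and4P[_ /eqP au /eqP av /forallP h]].
  rewrite mem_Hstar => /andP[kH _].
  apply: shifted_unique es => // l; have := h l.
  have [->|_] := eqVneq l u; first by rewrite (negPf uv); lia.
  by have [->|_ /eqP ->] := eqVneq l v; lia.
move=> ->; have [z zu zv] := third_ord4 u v.
have [kS kM km] : [/\ k22 n u v \in Hstar n, kmax (k22 n u v) = (4 * n)%:Z - (2 * n)%:Z
    & kmin (k22 n u v) = - (2 * n)%:Z].
  apply: (@shifted_boundary _ _ _ u z); last exact: es.
  - by rewrite eqxx (negPf uv); lia.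
  - by rewrite (negPf zu) (negPf zv).
  - by move=> i; have [->|_] := eqVneq i u; rewrite ?(negPf uv); case: (i == v); lia.
  - by move=> i; case: (i == u); case: (i == v); lia.
split=> //; rewrite /bd22 /onbd /type22 /ismax /ismin kM km luv !shiftedE.
rewrite !(eqxx, negPf uv, negPf vu) /=; apply/and4P; split; try by lia.
by apply/forallP => i; apply/implyP => /andP[/negPf iu /negPf iv]; rewrite shiftedE iu iv; lia.
Qed.

(** * The kernel as a sum of cosines *)

Section Kernel.
Variable R : realType.

(* The Chebyshev polynomial U_(m-1) at cos x: the continuous extension of
   sin (m x) / sin x. *)
Fixpoint chebU (m : nat) (x : R) : R :=
  if m is p.+1 then chebU p x * cos x + cos (p%:R * x) else 0.

Lemma chebU_sin (m : nat) (x : R) : sin (m%:R * x) = chebU m x * sin x.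
Proof.
elim: m => [|m IH] /=; first by rewrite !mul0r sin0.
by rewrite -natr1 mulrDl mul1r sinD IH; ring.
Qed.

(** The Dirichlet-type sum cos(a + (m+1)x) sin(mx) / sin x, in a form free of division and thus
    valid for every x. In the induction, [chebU_sin] and sin^2 = 1 - cos^2 leave a polynomial
    identity. *)
Lemma sum_cos_chebU (m : nat) (a x : R) :
  \sum_(s < m) cos (a + 2 * (s.+1%:R * x)) = cos (a + m.+1%:R * x) * chebU m x.
Proof.
elim: m => [|m IH]; first by rewrite big_ord0 mulr0.
have e (p : nat) : p.+1%:R * x = p%:R * x + x by rewrite -natr1 mulrDl mul1r.
rewrite big_ord_recr /= IH (e m.+1) addrA.
rewrite (_ : 2 * _ = m.+1%:R * x + m.+1%:R * x); last by ring.
rewrite addrA; set b := a + _.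
rewrite [cos (b + m.+1%:R * x)]cosD [cos (b + x)]cosD e.
rewrite [cos (_ * x + x)]cosD [sin (_ * x + x)]sinD chebU_sin.
have s2 : sin x * sin x = 1 - cos x * cos x by have := cos2Dsin2 x; rewrite !expr2; lra.
have -> : cos b * chebU m x + (cos b * (cos (m%:R * x) * cos x - chebU m x * sin x * sin x)
   - sin b * (chebU m x * sin x * cos x + cos (m%:R * x) * sin x)) =
  cos b * chebU m x + (cos b * (cos (m%:R * x) * cos x - chebU m x * (sin x * sin x))
   - sin b * (chebU m x * sin x * cos x + cos (m%:R * x) * sin x)) by ring.
by rewrite s2; ring.
Qed.

Lemma continuous_chebU (m : nat) : continuous (chebU m).
Proof.
elim: m => [|m IH] x /=; first exact: cst_continuous.
apply: (@continuousD _ R^o R^o (fun x => chebU m x * cos x) (fun x => cos (m%:R * x))).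
  by apply: (@continuousM _ R^o); [exact: IH | exact: continuous_cos].
apply: (@continuous_comp _ _ _ (fun x : R => m%:R * x) cos); last exact: continuous_cos.
exact: mulrl_continuous.
Qed.

(** Off the zeros of the denominator this is [chebU_sin]. At a zero, the quotient agrees with the
    continuous function [chebU] on a punctured neighbourhood, so it has the same limit. *)
Lemma sinqE (m : nat) (x : R) : sinq m x = chebU m (pi * x).
Proof.
rewrite /sinq; case: eqVneq => [s0|s0] /=; last first.
  by rewrite -mulrA chebU_sin mulfK.
apply/cvg_lim => //.
have : (chebU m (pi * y) @[y --> x^'] --> chebU m (pi * x))%classic.
  apply: cvg_trans; last first.
    apply: (@continuous_comp _ _ _ (fun x : R => pi * x) (chebU m)).
      exact: mulrl_continuous.
    exact: continuous_chebU.
  exact: cvg_within_filter.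
apply: cvg_trans; apply: near_eq_cvg.
(* Radius 1 suffices: consecutive zeros of sin(pi y) are 1 apart. *)
have := @dnbhs_ball R R x 1 ltr01; apply: filterS => y [xy /eqP yx].
rewrite -mulrA chebU_sin mulfK //.
(* As sin(pi x) = 0, sin(pi y) is cos(pi x) sin(pi (y - x)), and neither factor vanishes. *)
rewrite (_ : pi * y = pi * x + pi * (y - x)); last by ring.
rewrite sinD s0 mul0r add0r mulf_neq0 //.
  apply/eqP => c0; have := cos2Dsin2 (pi * x); rewrite s0 c0 expr0n addr0 => /esym/eqP.
  by rewrite oner_eq0.
have p0 := pi_gt0 R; have pos (z : R) : 0 < z < 1 -> sin (pi * z) != 0.
  move=> /andP[z0 z1]; rewrite gt_eqF // sin_gt0_pi // mulr_gt0 //=.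
  by rewrite -[ltRHS]mulr1 ltr_pM2l.
move: xy; rewrite /ball /= => xy.
have [yx'|xy'|/eqP] := ltrgtP y x; last by rewrite (negPf yx).
  rewrite -opprB mulrN sinN oppr_eq0; apply: pos.
  by move: xy; rewrite ger0_norm; lra.
by apply: pos; move: xy; rewrite ler0_norm; lra.
Qed.

Definition cosk (t : pt R) (k : lat) : R := cos (pi / 2 * \sum_(i < 4) (k i)%:~R * t i).

Lemma coskN (t : pt R) (k : lat) : cosk t (- k) = cosk t k.
Proof.
rewrite /cosk -[RHS]cosN -mulrN -sumrN; congr (cos (_ * _)).
by apply: eq_bigr => i _; rewrite latN intrN mulNr.
Qed.

Lemma phi_sym (t : pt R) (k : lat) : phi k t + phi (- k) t = (2 * cosk t k)%:C.
Proof.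
have -> : phi (- k) t = cosk t (- k) +i*
    sin (- (pi / 2 * \sum_(i < 4) (k i)%:~R * t i)).
  rewrite /phi /cosk; congr (_ +i* sin _); rewrite -mulrN -sumrN; congr (_ * _).
  by apply: eq_bigr => i _; rewrite latN intrN mulNr.
rewrite coskN sinN /phi -/(cosk t k).
by apply/eqP; rewrite eq_complex /= subrr mulr2n mulrDl mul1r !eqxx.
Qed.

Lemma sum_HstarN (V : nmodType) (m : nat) (P : pred lat) (F : lat -> V) :
  \sum_(k <- Hstar m | P k) F k = \sum_(k <- Hstar m | P (- k)) F (- k).
Proof. by rewrite -(perm_big _ (perm_HstarN m)) /= big_map. Qed.

(** Twice the sum pairs k with -k, and [phi_sym] cancels the imaginary parts. *)
Lemma sum_phi_real (m : nat) (w : lat -> R) (t : pt R) :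
  (forall k, w (- k) = w k) ->
  \sum_(k <- Hstar m) (w k)%:C * phi k t = (\sum_(k <- Hstar m) w k * cosk t k)%:C.
Proof.
move=> wN; apply: (@mulfI _ (2 : R[i])); first by rewrite pnatr_eq0.
rewrite mulr_natl mulr2n {2}sum_HstarN -big_split /= rmorph_sum mulr_sumr.
apply: eq_bigr => k _; rewrite wN -mulrDr phi_sym !rmorphM rmorph_nat; ring.
Qed.

(** Negation exchanges p and q, and the binomial coefficient is symmetric in them. *)
Lemma coef_opp (n : nat) (k : lat) : coef R n (- k) = coef R n k.
Proof.
rewrite /coef kmaxN kminN opprK addrC; case: ifP => // _.
set p := #|[pred i : 'I_4 | k i == kmax k]|; set q := #|[pred i : 'I_4 | k i == kmin k]|.
have -> : #|[pred i : 'I_4 | (- k) i == - kmin k]| = q.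
  by apply: eq_card => i; rewrite !inE latN eqr_opp.
have -> : #|[pred i : 'I_4 | (- k) i == - kmax k]| = p.
  by apply: eq_card => i; rewrite !inE latN eqr_opp.
by rewrite addnC -(bin_sub (leq_addr q p)) addKn.
Qed.

(** On the boundary this is [bin_types] divided by 6 times the binomial coefficient. The last sum
    has no term at [- k]: a point with two maxima and two minima keeps that pattern under
    negation. *)
Lemma coef_types (n : nat) (k : lat) : (0 < n)%N -> k \in Hstar n ->
  coef R n k = 1 / 2 * (1 + (~~ onbd n k)%:R)
    - 1 / 6 * \sum_(v < 4) \sum_(j < 4) ((bd12 n v j k)%:R + (bd12 n v j (- k))%:R)
    - 1 / 4 * \sum_(j < 4) ((bd13 n j k)%:R + (bd13 n j (- k))%:R)
    - 1 / 3 * \sum_(u < 4) \sum_(v < 4) (bd22 n u v k)%:R.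
Proof.
move=> n0 kS; rewrite /bd12 /bd13 /bd22 onbdN ismaxN isminN /coef.
move: kS; rewrite mem_Hstar inHstar_width => /andP[_ kw].
case: (boolP (onbd n k)) => [|kw']; last first.
  rewrite ifT; last by rewrite lt_neqAle kw' kw.
  by rewrite /= !(addr0, big1_eq, mulr0, subr0); field.
move=> /eqP {}kw; rewrite ifF; last by rewrite kw ltxx.
have [[x xE _] [y yE _]] := (kmaxP k, kminP k).
have := bin_types (ismax k) (ismin k) _ _ _ _ _ x y _ _ _ erefl erefl erefl erefl erefl.
have hxy i : ~~ (ismax k i && ismin k i).
  by apply/negP => /andP[/eqP h1 /eqP h2]; move: kw; rewrite -h1 -h2; lia.
move=> /(_ hxy); rewrite /ismax /ismin xE yE !eqxx => /(_ isT isT).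
rewrite -xE -yE -/(ismax k) -/(ismin k) /=.
set C := 'C(_, _); set N12 := (\sum_(v < 4) _)%N; set N13 := (\sum_(j < 4) _)%N.
set N22 := (\sum_(u < 4) _)%N => /eqP h.
have -> : \sum_(v < 4) \sum_(j < 4) ((type12 (ismax k) (ismin k) v j)%:R +
    (type12 (ismin k) (ismax k) v j)%:R) = N12%:R :> R.
  rewrite natr_sum; apply: eq_bigr => v _; rewrite natr_sum.
  by apply: eq_bigr => j _; rewrite natrD.
have -> : \sum_(j < 4) ((type13 (ismax k) (ismin k) j)%:R +
    (type13 (ismin k) (ismax k) j)%:R) = N13%:R :> R.
  by rewrite natr_sum; apply: eq_bigr => j _; rewrite natrD.
have -> : \sum_(u < 4) \sum_(v < 4) (type22 (ismax k) (ismin k) u v)%:R = N22%:R :> R.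
  by rewrite natr_sum; apply: eq_bigr => u _; rewrite natr_sum.
(* A zero binomial would turn [h] into 0 = 12. *)
have C0 : (C%:R : R) != 0 by rewrite pnatr_eq0; apply: contra_eqN h => /eqP ->.
move/(congr1 (fun m : nat => m%:R : R)): h; rewrite !(natrD, natrM) => h.
by apply: (mulfI C0); rewrite mulrCA divff // addr0; lra.
Qed.
End Kernel.

Arguments chebU {R} m x.
Arguments cosk {R} t k.

(** * Closed formula for the kernel *)

Section Formula.
Variable R : realType.

Lemma sum_indicator (s : seq lat) (P : pred lat) (F : lat -> R) :
  \sum_(k <- s) (P k)%:R * F k = \sum_(k <- s | P k) F k.
Proof.
rewrite [RHS]big_mkcond; apply: eq_bigr => k _.
by case: (P k); rewrite ?mul1r ?mul0r.
Qed.

(** The constant shift is orthogonal to vectors of zero sum. *)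
Lemma dot_shifted (e : 'I_4 -> int) (c : int) (t : pt R) : inRH t ->
  \sum_(i < 4) (shifted e c i)%:~R * t i = \sum_(i < 4) (e i)%:~R * t i.
Proof.
move=> t0; transitivity (\sum_(i < 4) ((e i)%:~R * t i - c%:~R * t i)).
  by apply: eq_bigr => i _; rewrite shiftedE intrB mulrBl.
by rewrite sumrB -mulr_sumr (t0 : \sum_(i < 4) t i = 0) mulr0 subr0.
Qed.

Lemma sum_delta (j : 'I_4) (c : nat) (t : pt R) :
  \sum_(i < 4) ((i == j)%:Z * c%:Z)%:~R * t i = c%:R * t j.
Proof.
rewrite (bigD1 j) //= eqxx mul1r big1 ?addr0 // => i /negPf ->.
by rewrite (_ : false%:Z * c%:Z = 0) ?mul0r // mulr0z mul0r.
Qed.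

Lemma cosk_k12 (n : nat) (v j : 'I_4) (s : nat) (t : pt R) : inRH t ->
  cosk t (k12 n v j s) = cos (2 * pi * n%:R * t j + 2 * (s%:R * (pi * t v))).
Proof.
move=> t0; rewrite /cosk dot_shifted //; congr cos.
under eq_bigr do rewrite intrD mulrDl.
by rewrite big_split /= !sum_delta !natrM; field.
Qed.

Lemma cosk_k13 (n : nat) (j : 'I_4) (t : pt R) : inRH t ->
  cosk t (k13 n j) = cos (2 * pi * n%:R * t j).
Proof.
move=> t0; rewrite /cosk dot_shifted //; congr cos.
by rewrite sum_delta natrM; field.
Qed.

Lemma cosk_k22 (n : nat) (u v : 'I_4) (t : pt R) : inRH t ->
  cosk t (k22 n u v) = cos (2 * pi * n%:R * (t u + t v)).
Proof.
move=> t0; rewrite /cosk dot_shifted //; congr cos.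
under eq_bigr do rewrite intrD mulrDl.
by rewrite big_split /= !sum_delta !natrM; field.
Qed.

Lemma sum_bd12 (n : nat) (v j : 'I_4) (t : pt R) : (0 < n)%N -> inRH t -> j != v ->
  \sum_(k <- Hstar n | bd12 n v j k) cosk t k =
  chebU n.-1 (pi * t v) * cos (n%:R * pi * (2 * t j + t v)).
Proof.
move=> n0 t0 jv; rewrite -big_filter (perm_big _ (perm_bd12 n _ _ jv)) big_map.
rewrite -{1}(prednK n0) big_add1 big_mkord.
under eq_bigr do rewrite cosk_k12 //.
rewrite sum_cos_chebU mulrC prednK //; congr (_ * cos _); ring.
Qed.

Lemma sum_bd13 (n : nat) (j : 'I_4) (t : pt R) : (0 < n)%N -> inRH t ->
  \sum_(k <- Hstar n | bd13 n j k) cosk t k = cos (2 * pi * n%:R * t j).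
Proof.
move=> n0 t0; rewrite -big_filter (perm_big _ (perm_bd13 _ _ n0)) big_seq1.
exact: cosk_k13.
Qed.

Lemma sum_bd22 (n : nat) (u v : 'I_4) (t : pt R) : (0 < n)%N -> inRH t -> (u < v)%N ->
  \sum_(k <- Hstar n | bd22 n u v k) cosk t k = cos (2 * pi * n%:R * (t u + t v)).
Proof.
move=> n0 t0 uv; rewrite -big_filter (perm_big _ (perm_bd22 _ _ _ n0 uv)) big_seq1.
exact: cosk_k22.
Qed.

Lemma sum_bdN (n : nat) (P : pred lat) (t : pt R) :
  \sum_(k <- Hstar n | P (- k)) cosk t k = \sum_(k <- Hstar n | P k) cosk t k.
Proof. by rewrite [RHS]sum_HstarN; apply: eq_bigr => k _; rewrite coskN. Qed.

(** Spreads in H are multiples of 4, so a spread below 4n is at most 4(n - 1). *)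
Lemma sum_interior (n : nat) (F : lat -> R) : (0 < n)%N ->
  \sum_(k <- Hstar n | ~~ onbd n k) F k = \sum_(k <- Hstar n.-1) F k.
Proof.
move=> n0; rewrite -big_filter; apply: perm_big; apply: uniq_perm.
- by rewrite filter_uniq ?uniq_Hstar.
- exact: uniq_Hstar.
move=> k; rewrite mem_filter !mem_Hstar !inHstar_width /onbd andbCA.
case kH : (inH k) => //=; have := width_dvd4 _ kH.
by move: (kmax k - kmin k) => w; lia.
Qed.

Lemma sum_coef_cosk (n : nat) (t : pt R) : (0 < n)%N -> inRH t ->
  \sum_(k <- Hstar n) coef R n k * cosk t k =
  1 / 2 * (\sum_(k <- Hstar n) cosk t k + \sum_(k <- Hstar n.-1) cosk t k)
  - 1 / 3 * \sum_(v < 4) (chebU n.-1 (pi * t v) *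
      \sum_(j < 4 | j != v) cos (n%:R * pi * (2 * t j + t v)))
  - 1 / 2 * \sum_(j < 4) cos (2 * pi * n%:R * t j)
  - 1 / 3 * \sum_(u < 4) \sum_(v < 4 | (u < v)%N) cos (2 * pi * n%:R * (t u + t v)).
Proof.
move=> n0 t0; rewrite big_seq.
have distr (a b c d x y z w h : R) : (a * x - b * y - c * z - d * w) * h =
  a * (x * h) - b * (y * h) - c * (z * h) - d * (w * h) by ring.
under eq_bigr => k kS do rewrite (coef_types R _ _ n0 kS) distr.
rewrite -big_seq !sumrB -!mulr_sumr.
congr (_ - _ - _ - _).
- congr (_ * _); rewrite -(sum_interior _ _ n0) -(sum_indicator _ (fun k => ~~ onbd n k)) -big_split /=.
  by apply: eq_bigr => k _; rewrite mulrDl mul1r.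
(* A pattern and its reversal contribute equally because [cosk] is even, whence the factor 2 turning
   1/6 into 1/3; likewise 1/4 becomes 1/2 below. *)
- transitivity (1 / 6 * \sum_(v < 4) (2 * (chebU n.-1 (pi * t v) *
      \sum_(j < 4 | j != v) cos (n%:R * pi * (2 * t j + t v)))) : R); last first.
    by rewrite -mulr_sumr; field.
  congr (_ * _); under eq_bigr do rewrite mulr_suml.
  rewrite exchange_big; apply: eq_bigr => v _.
  under eq_bigr do rewrite mulr_suml.
  rewrite exchange_big /= mulr_sumr mulr_sumr [RHS]big_mkcond; apply: eq_bigr => j _.
  under eq_bigr do rewrite mulrDl.
  rewrite big_split /= !sum_indicator (sum_bdN n (bd12 n v j)).
  (* For j = v the pattern is impossible and the sum is empty. *)
  case: ifPn => jv; first by rewrite sum_bd12 //; ring.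
  by rewrite big1 ?addr0 // => k /andP[_ /and5P[]]; rewrite (negPf jv).
- transitivity (1 / 4 * \sum_(j < 4) (2 * cos (2 * pi * n%:R * t j)) : R); last first.
    by rewrite -mulr_sumr; field.
  congr (_ * _); under eq_bigr do rewrite mulr_suml.
  rewrite exchange_big; apply: eq_bigr => j _.
  under eq_bigr do rewrite mulrDl.
  rewrite big_split /= !sum_indicator (sum_bdN n (bd13 n j)) !sum_bd13 //; ring.
- congr (_ * _); under eq_bigr do rewrite mulr_suml.
  rewrite exchange_big; apply: eq_bigr => u _.
  under eq_bigr do rewrite mulr_suml.
  rewrite exchange_big /= [RHS]big_mkcond; apply: eq_bigr => v _.
  rewrite sum_indicator; case: ifPn => uv; first exact: sum_bd22.
  by rewrite big1 // => k /andP[_ /and4P[]]; rewrite (negPf uv).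
Qed.

Lemma DH_real (m : nat) (t : pt R) : DH m t = (\sum_(k <- Hstar m) cosk t k)%:C.
Proof.
have := @sum_phi_real R m (fun=> 1) t (fun=> erefl).
under eq_bigr do rewrite mul1r; under [in X in _ = X -> _]eq_bigr do rewrite mul1r.
exact.
Qed.

Lemma Phistar_real (n : nat) (t : pt R) : Phistar n t =
  (1 / (4 * n ^ 3)%:R * \sum_(k <- Hstar n) coef R n k * cosk t k)%:C.
Proof. by rewrite /Phistar (sum_phi_real _ _ _ _ (coef_opp R n)) [RHS]rmorphM. Qed.

End Formula.

Theorem theorem3p18 (R : realType) (n : nat) (f : pt R -> R[i]) :
  (1 <= n)%N ->
  continuous_on_set (@inOmegaHbar R) f ->
  [/\ inTn n (Interp n f),
      (forall j : lat, j \in Hstar n ->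
         Interp n f (pt_of R n j) =
           (if inHcirc n j then f (pt_of R n j)
            else \sum_(k <- Sset n j) f (pt_of R n k))),
      (forall t : pt R, inRH t -> complex.Im (Phistar n t) = 0)
    & (forall t : pt R, inRH t -> Phistar n t = Phistar_formula n t)].
Proof.
move=> n0 _; split.
- exact: Interp_inTn.
- move=> j jS; have jH : inH j by move: jS; rewrite mem_Hstar => /andP[].
  (* The value at a node is the sum over its class, which is [Sset] in general and a single point in
     the interior. *)
  rewrite Interp_node // inHcirc_width // jH; case: ifP => [jw|_]; last by rewrite SsetE.
  by rewrite (perm_big _ (cls_interior _ _ jS jw)) big_seq1.
- by move=> t _; rewrite Phistar_real.
- move=> t t0; rewrite Phistar_real sum_coef_cosk // /Phistar_formula !DH_real.
  have -> : \sum_(v < 4) (sinq n.-1 (t v) *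
      \sum_(j < 4 | j != v) cos (n%:R * pi * (2 * t j + t v))) =
    \sum_(v < 4) (chebU n.-1 (pi * t v) *
      \sum_(j < 4 | j != v) cos (n%:R * pi * (2 * t j + t v))).
    by apply: eq_bigr => v _; rewrite sinqE.
  rewrite [LHS]rmorphM; congr (_ * _); rewrite !rmorphB; congr (_ - _ - _ - _).
  by rewrite [LHS]rmorphM rmorphD.
Qed.
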